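(* Let $\xi$ be an $n$-dimensional multivariate Gaussian random vector with known mean and covariance matrix. Fix $0<\epsilon<\frac12$ and $\beta\in(0,1)$. Let $G_{\epsilon,\beta}$ be the set of all $(a,b,c,d,k,f_1,f_2)$ with $a,c\in\mathbb{R}^n$ and $b,d,k,f_1,f_2\in\mathbb{R}$ (so $G_{\epsilon,\beta}\subset\mathbb{R}^{2n+5}$) such that $$\mathbb{P}(|a^T\xi+b|\le f_1)\ge 1-\beta\epsilon,\qquad \mathbb{P}(|c^T\xi+d|\le f_2)\ge 1-(1-\beta)\epsilon,\qquad f_1^2+f_2^2\le k.$$ Let $G^{proj}_{\epsilon,\beta}$ be the projection of $G_{\epsilon,\beta}$ onto the variables $(a,b,c,d,k)$. Then $G^{proj}_{\epsilon,\beta}$ is convex and $G^{proj}_{\epsilon,\beta}\subseteq H_\epsilon$.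
   Context: The quadratic chance constraint set is $$H_\epsilon = \{(a,b,c,d,k)\in\mathbb{R}^n\times\mathbb{R}\times\mathbb{R}^n\times\mathbb{R}\times\mathbb{R} : \mathbb{P}((a^T\xi+b)^2+(c^T\xi+d)^2\le k)\ge 1-\epsilon\}.$$ *)

(* Defs.v *)
From HB Require Import structures.
From mathcomp Require Import all_boot all_order all_algebra.
From mathcomp Require Import all_classical all_reals all_analysis.

Set Implicit Arguments.
Unset Strict Implicit.
Unset Printing Implicit Defensive.

Import Order.TTheory GRing.Theory Num.Theory.
Import numFieldNormedType.Exports.

Local Open Scope classical_set_scope.
Local Open Scope ring_scope.

(* N(m, v), parametrized by the variance v >= 0.  The case v = 0 is split off
   because [normal_prob m 0] is the uniform law on [0, 1], not the point mass. *)
Definition gaussian_law (R : realType) (m v : R) : set R -> \bar R :=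
  if v == 0 then \d_m else normal_prob m (Num.sqrt v).

Definition dotp (R : realType) (n : nat) (a x : 'cV[R]_n) : R :=
  (a^T *m x) 0 0.

(* A random vector is a family of n real random variables on a common
   probability space; this is its value at the outcome w. *)
Definition rvec (d : measure_display) (T : measurableType d) (R : realType)
    (P : probability T R) (n : nat) (xi : 'I_n -> {RV P >-> R}) (w : T)
    : 'cV[R]_n :=
  \col_i xi i w.

(* xi ~ N(mu, Sigma), with mean mu and covariance matrix Sigma: every linear
   combination a^T xi has law N(a^T mu, a^T Sigma a).  Sigma may be singular;
   it is symmetric positive semidefinite because it is a covariance matrix. *)
Definition gaussian_vector (d : measure_display) (T : measurableType d)
    (R : realType) (P : probability T R) (n : nat)
    (xi : 'I_n -> {RV P >-> R}) (mu : 'cV[R]_n) (Sigma : 'M[R]_n) : Prop :=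
  [/\ forall i, ('E_P[xi i] = (mu i 0)%:E)%E,
      forall i j, covariance P (xi i) (xi j) = (Sigma i j)%:E &
      forall (a : 'cV[R]_n) (A : set R), measurable A ->
        P [set w | A (dotp a (rvec xi w))] =
        gaussian_law (dotp a mu) (dotp a (Sigma *m a)) A].

(* Points (a, b, c, d, k); the copies R^o carry the vector space structure. *)
Definition qspace (R : realType) (n : nat) : lmodType R :=
  ('cV[R]_n * R^o * 'cV[R]_n * R^o * R^o)%type.

(* Points (a, b, c, d, k, f1, f2). *)
Definition qspace_ext (R : realType) (n : nat) : lmodType R :=
  (qspace R n * R^o * R^o)%type.

Definition chance_set (d : measure_display) (T : measurableType d)
    (R : realType) (P : probability T R) (n : nat)
    (xi : 'I_n -> {RV P >-> R}) (eps : R) : set (qspace R n) :=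
  [set x | let: (a, b, c, d, k) := x in
    ((1 - eps)%:E <=
      P [set w | (dotp a (rvec xi w) + b) ^+ 2 +
                 (dotp c (rvec xi w) + d) ^+ 2 <= k]%R)%E].

Definition split_set (d : measure_display) (T : measurableType d)
    (R : realType) (P : probability T R) (n : nat)
    (xi : 'I_n -> {RV P >-> R}) (eps beta : R) : set (qspace_ext R n) :=
  [set x | let: (a, b, c, d, k, f1, f2) := x in
    [/\ ((1 - beta * eps)%:E <=
          P [set w | `|dotp a (rvec xi w) + b| <= f1]%R)%E,
        ((1 - (1 - beta) * eps)%:E <=
          P [set w | `|dotp c (rvec xi w) + d| <= f2]%R)%E &
        f1 ^+ 2 + f2 ^+ 2 <= k]].

Definition qproj (R : realType) (n : nat) (x : qspace_ext R n) : qspace R n :=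
  x.1.1.

Definition split_set_proj (d : measure_display) (T : measurableType d)
    (R : realType) (P : probability T R) (n : nat)
    (xi : 'I_n -> {RV P >-> R}) (eps beta : R) : set (qspace R n) :=
  @qproj R n @` split_set xi eps beta.

(* Main.v *)
(* A random variable N(M, s^2) lies in [-f, f] with probability G(u) + G(w),
   where u = (f - M) / s, w = (f + M) / s and G(x) is the standard normal mass
   of [0, x].  Each half-line from 0 has mass 1/2, so a probability above 1/2
   forces u and w to be nonnegative, and there G is concave and nondecreasing.
   Hence {(M, s, f)} is the perspective of a convex set and is convex; it is
   also closed under decreasing s, so composing it with the affine map
   (a, b) |-> M and the seminorm s = sqrt (a^T Sigma a) keeps it convex.
   The inclusion is the union bound. *)
Require Import Defs.
From HB Require Import structures.
From mathcomp Require Import all_boot all_order all_algebra.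
From mathcomp Require Import all_classical all_reals all_analysis.
From mathcomp Require Import measurable_realfun ring lra.
Set Implicit Arguments.
Unset Strict Implicit.
Unset Printing Implicit Defensive.
Import Order.TTheory GRing.Theory Num.Theory.
Import numFieldNormedType.Exports.
Local Open Scope classical_set_scope.
Local Open Scope ring_scope.

(** * Standard normal mass: standardization, symmetry, and concavity on the half-line *)

Section standard_normal.
Context {R : realType}.
Implicit Types x y z w t u v m s : R.

Lemma normal_pdf01E x :
  normal_pdf 0 1 x = normal_peak 1 * expR (- x ^+ 2 / 2).
Proof.
rewrite normal_pdfE ?oner_eq0// /normal_fun subr0.
by rewrite expr1n.
Qed.

Lemma normal_pdf01_opp x : normal_pdf 0 1 (- x) = normal_pdf 0 1 x.
Proof. by rewrite !normal_pdf01E sqrrN. Qed.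

Lemma normal_pdf01_nincr x y :
  0 <= x -> x <= y -> normal_pdf 0 1 y <= normal_pdf 0 1 x.
Proof.
move=> x0 xy; rewrite !normal_pdf01E ler_wpM2l ?normal_peak_ge0// ler_expR.
rewrite ler_pM2r ?invr_gt0// lerN2 ler_pXn2r// nnegrE.
exact: le_trans xy.
Qed.

Lemma normal_pdf_affine m s x : 0 < s ->
  normal_pdf m s (m + s * x) * s = normal_pdf 0 1 x.
Proof.
move=> s0; rewrite normal_pdf01E normal_pdfE ?gt_eqF// /normal_fun /normal_peak.
rewrite -(mulrnAr (s ^+ 2) pi 2).
rewrite sqrtrM ?sqr_ge0// sqrtr_sqr gtr0_norm// expr1n mul1r invfM.
have -> : - (m + s * x - m) ^+ 2 / (s ^+ 2 *+ 2) = - x ^+ 2 / 2.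
  by field; rewrite gt_eqF.
by rewrite mulrC !mulrA divff ?gt_eqF// mul1r.
Qed.

(** Substituting [z |-> m + s * z], whose derivative [s] cancels the factor [1 / s] of the
    density. *)
Lemma normal_prob_affine m s x y : 0 < s -> x <= y ->
  normal_prob m s `[m + s * x, m + s * y] = normal_prob 0 1 `[x, y].
Proof.
move=> s0 xy; rewrite /normal_prob.
pose F (z : R^o) : R^o := m + s *: z.
have dF z : is_derive z 1 F s.
  by rewrite /F; apply: is_derive_eq; rewrite add0r [_%:A]mulr1 mul1r.
have F'E : F^`()%classic = cst s.
  by apply/funext => z; rewrite derive1E; exact: derive_val.
have cF : continuous F.
  by move=> z; apply/differentiable_continuous/derivable1_diffP.
rewrite (@integration_by_substitution_increasing R F (normal_pdf m s) x y xy).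
- apply: eq_integral => z _; rewrite F'E/= !fctE /F.
  by rewrite normal_pdf_affine.
- by move=> a b _ _ ab; rewrite /F ltrD2l ltr_pM2l.
- by rewrite F'E => ? _; exact: cvg_cst.
- by rewrite F'E; exact: is_cvg_cst.
- by rewrite F'E; exact: is_cvg_cst.
- split => [z _||].
  + by [].
  + by apply: cvg_at_right_filter; exact: cF.
  + by apply: cvg_at_left_filter; exact: cF.
- by apply: continuous_subspaceT; apply: continuous_normal_pdf; rewrite gt_eqF.
Qed.

Lemma normal_prob01_itvN x : 0 <= x ->
  normal_prob 0 1 `[- x, 0] = normal_prob 0 1 `[0, x].
Proof.
move=> x0; rewrite /normal_prob.
have := @integration_by_substitution_oppr R (normal_pdf 0 1) 0 x x0.
rewrite oppr0 => ->.
  by apply: eq_integral => y _ /=; rewrite normal_pdf01_opp.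
by apply: continuous_subspaceT; apply: continuous_normal_pdf; rewrite oner_eq0.
Qed.

(** The function G of the overview: Φ(x) - 1/2 for [x >= 0], with Φ the standard normal distribution
    function, and 0 for negative [x], where the interval is empty. *)
Definition half_mass x : R := fine (normal_prob 0 1 `[0, x]).

Lemma half_massE x : normal_prob 0 1 `[0, x] = (half_mass x)%:E.
Proof.
by rewrite /half_mass fineK// fin_num_measure.
Qed.

Lemma measurable_std_normal_pdf (A : set R) :
  measurable_fun A (fun r => (normal_pdf (0 : R) 1 r)%:E : \bar R).
Proof. by apply/measurable_EFinP/measurable_funTS; exact: measurable_normal_pdf. Qed.

Lemma normal_prob01_cat x y z : x <= y -> y <= z ->
  normal_prob 0 1 `[x, z] =
  (normal_prob 0 1 `[x, y] + normal_prob 0 1 `[y, z])%E :> \bar R.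
Proof.
move=> xy yz.
(* Dropping the shared endpoint [y] from the second interval leaves its integral unchanged and makes
   the pieces disjoint. *)
rewrite /normal_prob -[in X in (_ + X)%E]integral_itv_obnd_cbnd; last first.
  exact: measurable_std_normal_pdf.
rewrite -ge0_integral_setU//=.
- by rewrite -itv_bndbnd_setU ?bnd_simp.
- exact: measurable_std_normal_pdf.
- by move=> r _; rewrite lee_fin normal_pdf_ge0.
- apply/disj_setPS => r []/=; rewrite !in_itv/= => /andP[_ ry] /andP[yr _].
  by move: (lt_le_trans yr ry); rewrite ltxx.
Qed.

Lemma half_mass_cat x y : 0 <= x -> x <= y ->
  (half_mass y)%:E = ((half_mass x)%:E + normal_prob 0 1 `[x, y])%E.
Proof. by move=> x0 xy; rewrite -!half_massE (normal_prob01_cat x0 xy). Qed.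

Lemma normal_prob01_center u v : 0 <= u -> 0 <= v ->
  normal_prob 0 1 `[- v, u] = (half_mass u + half_mass v)%:E.
Proof.
move=> u0 v0; rewrite (@normal_prob01_cat (- v) 0 u)//; last by rewrite oppr_le0.
by rewrite normal_prob01_itvN// !half_massE EFinD addeC.
Qed.

(** By symmetry [[- x, x]] has mass [2 * half_mass x], which is at most 1. *)
Lemma half_mass_le_half x : 0 <= x -> half_mass x <= 1 / 2.
Proof.
move=> x0; have := probability_le1 (normal_prob 0 1) (measurable_itv `[- x, x]).
rewrite -[X in (X <= _)%E]/(normal_prob 0 1 `[- x, x]).
by rewrite normal_prob01_center// lee_fin; lra.
Qed.

(* As the density decreases on the half-line, its value at [z] is a supergradient. *)
Lemma half_mass_tangent z w : 0 <= z -> 0 <= w ->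
  half_mass w <= half_mass z + normal_pdf 0 1 z * (w - z).
Proof.
move=> z0 w0.
have cst_itv x y : x <= y ->
    (\int[lebesgue_measure]_(r in `[x, y]) (normal_pdf 0 1 z)%:E =
     (normal_pdf 0 1 z * (y - x))%:E)%E.
  move=> xy; rewrite integral_cst//= lebesgue_measure_itv/= lte_fin.
  case: ltP => xy'; first by rewrite EFinM EFinB.
  by rewrite (le_anti (introT andP (conj xy xy'))) subrr mule0 mulr0.
have [zw|/ltW wz] := leP z w.
  rewrite -lee_fin (half_mass_cat z0 zw) EFinD leeD2l// -cst_itv//.
  apply: ge0_le_integral => //=.
  - by move=> r _; rewrite lee_fin normal_pdf_ge0.
  - exact: measurable_std_normal_pdf.
  - by move=> r; rewrite in_itv/= lee_fin => /andP[zr _]; exact: normal_pdf01_nincr.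
rewrite -lerBlDr -mulrN opprB -lee_fin (half_mass_cat w0 wz) EFinD leeD2l//.
rewrite -cst_itv//; apply: ge0_le_integral => //=.
- by move=> r _; rewrite lee_fin normal_pdf_ge0.
- exact: measurable_std_normal_pdf.
- move=> r; rewrite in_itv/= lee_fin => /andP[wr rz].
  by apply: normal_pdf01_nincr => //; exact: le_trans wr.
Qed.

(** Average the supergradient inequalities taken at the combination [z]; the slope terms cancel. *)
Lemma half_mass_concave s t x y : 0 <= s -> 0 <= t -> s + t = 1 ->
  0 <= x -> 0 <= y ->
  s * half_mass x + t * half_mass y <= half_mass (s * x + t * y).
Proof.
move=> s0 t0 st x0 y0; set z := s * x + t * y.
have z0 : 0 <= z by rewrite addr_ge0// mulr_ge0.
apply: le_trans (lerD (ler_wpM2l s0 (half_mass_tangent z0 x0))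
                      (ler_wpM2l t0 (half_mass_tangent z0 y0))) _.
move: (half_mass z) (normal_pdf 0 1 z) => h p.
have -> : s * (h + p * (x - z)) + t * (h + p * (y - z)) =
          (s + t) * h + p * (z - (s + t) * z) by rewrite /z; ring.
by rewrite st !mul1r subrr mulr0 addr0.
Qed.

Lemma half_mass_le x y : 0 <= x -> x <= y -> half_mass x <= half_mass y.
Proof. by move=> x0 xy; rewrite -lee_fin (half_mass_cat x0 xy) leeDl. Qed.

End standard_normal.

(** * Bands under a one-dimensional Gaussian law *)

Section band.
Context {R : realType}.
Implicit Types m v p b f s t M u w : R.

(* [M] and [s] are the mean and the standard deviation. *)
Definition band_ok p M s f : Prop :=
  `|M| <= f /\
  (s = 0 \/ exists u w, [/\ 0 <= u, 0 <= w, p <= half_mass u + half_mass w,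
                            s * u <= f - M & s * w <= f + M]).

(** The band is an interval with standardized endpoints [- w] and [u]. As [u + w = 2 * f / s], the
    test [- w <= u] means [0 <= f]; when it fails the band is empty. *)
Lemma gaussian_law_band m v b f : 0 < v ->
  let s := Num.sqrt v in
  let u := (f - (m + b)) / s in let w := (f + (m + b)) / s in
  gaussian_law m v [set x | `|x + b| <= f] =
  if - w <= u then normal_prob 0 1 `[- w, u] else 0%E.
Proof.
move=> v0 s u w; have s0 : 0 < s by rewrite sqrtr_gt0.
rewrite /gaussian_law gt_eqF//.
have -> : [set x | `|x + b| <= f] = `[m + s * - w, m + s * u]%classic.
  apply/seteqP; split => x /=; rewrite in_itv/= ler_norml /u /w mulrN;
    by rewrite ![s * _]mulrC !divfK ?gt_eqF//; lra.
case: ifPn => wu; first by rewrite normal_prob_affine.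
rewrite set_itv_ge ?measure0// bnd_simp lerD2l ler_pM2l//.
Qed.

(** For [v > 0], a level above 1/2 puts 0 between [- w] and [u], so the mass splits into two values
    of [half_mass]. Bounding [s * u] and [s * w] instead of dividing by [s] gives the perspective
    form; for [v = 0] the law is a point mass and only [|M| <= f] remains. *)
Lemma gaussian_law_bandP p m v b f : 0 <= v -> 1 / 2 < p -> p <= 1 ->
  (p%:E <= gaussian_law m v [set x | `|x + b| <= f]%R)%E <->
  band_ok p (m + b) (Num.sqrt v) f.
Proof.
rewrite le_eqVlt => /predU1P[<-|v0] p2 p1.
  rewrite /gaussian_law eqxx diracE sqrtr0 /band_ok lee_fin.
  have [mem|/negP nmem] := boolP (m \in _).
    by split => // _; split; [rewrite inE in mem|left].
  rewrite mulr0n; split => [|[Mf _]]; first by lra.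
  by exfalso; apply: nmem; rewrite inE.
rewrite gaussian_law_band//; set s := Num.sqrt v.
have s0 : 0 < s by rewrite sqrtr_gt0.
set u := (f - _) / s; set w := (f + _) / s.
have sw : s * w = f + (m + b) by rewrite mulrC divfK// gt_eqF.
have su : s * u = f - (m + b) by rewrite mulrC divfK// gt_eqF.
split.
  case: ifPn => wu; last by rewrite lee_fin; lra.
  have sub (x y x' y' : R) : x' <= x -> y <= y' ->
      (normal_prob 0 1 `[x, y] <= normal_prob 0 1 `[x', y'])%E.
    move=> xx yy; apply: le_measure; rewrite ?inE//=.
    by apply: subset_itv; rewrite bnd_simp.
  move=> pwu.
  (* A negative [u] would put the interval inside [[- w, 0]], of mass at most 1/2 < [p]; a negative
     [w] would put it inside [[0, u]]. *)
  have u0 : 0 <= u.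
    rewrite leNgt; apply/negP => u0.
    have w0 : 0 <= w by lra.
    have := le_trans pwu (sub _ _ _ _ (lexx _) (ltW u0)).
    rewrite normal_prob01_itvN// half_massE lee_fin.
    by have := half_mass_le_half w0; lra.
  have w0 : 0 <= w.
    rewrite leNgt; apply/negP => w0.
    have := le_trans pwu (sub _ _ 0 _ _ (lexx _)).
    rewrite half_massE lee_fin.
    by have := half_mass_le_half u0; lra.
  split.
    rewrite ler_norml; move: (mulr_ge0 (ltW s0) u0) (mulr_ge0 (ltW s0) w0).
    by rewrite su sw; lra.
  right; exists u, w; rewrite su sw; split => //.
  by rewrite normal_prob01_center// lee_fin in pwu.
case=> Mf [s00|[u' [w' [u0 w0 puw suf swf]]]].
  by move: s0; rewrite s00 ltxx.
have u'u : u' <= u by rewrite -(ler_pM2l s0) su.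
have w'w : w' <= w by rewrite -(ler_pM2l s0) sw.
have u00 := le_trans u0 u'u; have w00 := le_trans w0 w'w.
rewrite ifT; last by lra.
rewrite normal_prob01_center// lee_fin.
by have := half_mass_le u0 u'u; have := half_mass_le w0 w'w; lra.
Qed.

(** The perspective argument: witnesses are mixed with weights proportional to [t * s1] and
    [(1 - t) * s2], and concavity of [half_mass] keeps the level. Mixed witnesses are nonnegative,
    so a smaller [s] only relaxes the bounds. *)
Lemma band_ok_convex p t s M1 s1 f1 M2 s2 f2 : 0 < t -> t < 1 ->
  0 <= s -> 0 <= s1 -> 0 <= s2 -> s <= t * s1 + (1 - t) * s2 ->
  band_ok p M1 s1 f1 -> band_ok p M2 s2 f2 ->
  band_ok p (t * M1 + (1 - t) * M2) s (t * f1 + (1 - t) * f2).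
Proof.
move=> t0 t1 s_ge0 s1_ge0 s2_ge0 sle [Mf1 H1] [Mf2 H2].
have t'0 : 0 < 1 - t by lra.
split.
  apply: le_trans (ler_normD _ _) _.
  by rewrite !normrM (gtr0_norm t0) (gtr0_norm t'0) lerD// ler_pM2l.
have [->|sn0] := eqVneq s 0; [by left|right].
have s_gt0 : 0 < s by rewrite lt_neqAle eq_sym sn0.
(* A point with zero deviation can borrow the witnesses of the other, since its bounds then reduce
   to [|M| <= f]; both deviations cannot vanish because [s > 0]. *)
suff [u1 [w1 [u2 [w2 [[u10 w10 p1 su1 sw1] [u20 w20 p2 su2 sw2]]]]]] :
  exists u1 w1 u2 w2,
   [/\ 0 <= u1, 0 <= w1, p <= half_mass u1 + half_mass w1,
       s1 * u1 <= f1 - M1 & s1 * w1 <= f1 + M1] /\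
   [/\ 0 <= u2, 0 <= w2, p <= half_mass u2 + half_mass w2,
       s2 * u2 <= f2 - M2 & s2 * w2 <= f2 + M2].
  set s' := t * s1 + (1 - t) * s2 in sle.
  have s'0 : 0 < s' := lt_le_trans s_gt0 sle.
  pose x := t * s1 / s'; pose y := (1 - t) * s2 / s'.
  have x0 : 0 <= x by rewrite divr_ge0 ?mulr_ge0// ltW.
  have y0 : 0 <= y by rewrite divr_ge0 ?mulr_ge0// ltW.
  have xy : x + y = 1 by rewrite -mulrDl divff// gt_eqF.
  have s'x a : s' * (x * a) = t * (s1 * a).
    by rewrite /x; field; rewrite gt_eqF.
  have s'y a : s' * (y * a) = (1 - t) * (s2 * a).
    by rewrite /y; field; rewrite gt_eqF.
  have le_mix a1 a2 c1 c2 : 0 <= a1 -> 0 <= a2 -> s1 * a1 <= c1 -> s2 * a2 <= c2 ->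
      s * (x * a1 + y * a2) <= t * c1 + (1 - t) * c2.
    move=> a10 a20 sa1 sa2.
    apply: (@le_trans _ _ (s' * (x * a1 + y * a2))).
      by rewrite ler_wpM2r// addr_ge0// mulr_ge0.
    by rewrite mulrDr s'x s'y lerD// ler_pM2l.
  exists (x * u1 + y * u2), (x * w1 + y * w2); split.
  - by rewrite addr_ge0// mulr_ge0.
  - by rewrite addr_ge0// mulr_ge0.
  - have := half_mass_concave x0 y0 xy u10 u20.
    have := half_mass_concave x0 y0 xy w10 w20.
    have := ler_wpM2l x0 p1; have := ler_wpM2l y0 p2.
    have : x * p + y * p = p by rewrite -mulrDl xy mul1r.
    by rewrite !mulrDr; lra.
  - have -> : t * f1 + (1 - t) * f2 - (t * M1 + (1 - t) * M2) =
        t * (f1 - M1) + (1 - t) * (f2 - M2) by ring.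
    exact: le_mix.
  - have -> : t * f1 + (1 - t) * f2 + (t * M1 + (1 - t) * M2) =
        t * (f1 + M1) + (1 - t) * (f2 + M2) by ring.
    exact: le_mix.
case: H1 => [s10|[u1 [w1 H1]]]; case: H2 => [s20|[u2 [w2 H2]]].
- by move: sle; rewrite s10 s20 !mulr0 addr0 leNgt s_gt0.
- exists u2, w2, u2, w2; split => //; case: H2 => u20 w20 pH _ _.
  move: Mf1; rewrite ler_norml => Mf1.
  by rewrite s10 !mul0r; split => //; lra.
- exists u1, w1, u1, w1; split => //; case: H1 => u10 w10 pH _ _.
  move: Mf2; rewrite ler_norml => Mf2.
  by rewrite s20 !mul0r; split => //; lra.
- by exists u1, w1, u2, w2.
Qed.

End band.

(** * Bilinearity of the dot product, and the seminorm of a semidefinite form *)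

Section dotp_theory.
Context {R : realType} {n : nat}.
Implicit Types (a b x y : 'cV[R]_n) (c : R).

Lemma dotpDl a b x : dotp (a + b) x = dotp a x + dotp b x.
Proof. by rewrite /dotp linearD/= mulmxDl mxE. Qed.

Lemma dotpZl c a x : dotp (c *: a) x = c * dotp a x.
Proof. by rewrite /dotp linearZ/= -scalemxAl mxE. Qed.

Lemma dotpDr a x y : dotp a (x + y) = dotp a x + dotp a y.
Proof. by rewrite /dotp mulmxDr mxE. Qed.

Lemma dotpZr c a x : dotp a (c *: x) = c * dotp a x.
Proof. by rewrite /dotp -scalemxAr mxE. Qed.

Lemma dotpE a x : dotp a x = \sum_i a i 0 * x i 0.
Proof. by rewrite /dotp mxE; apply: eq_bigr => i _; rewrite mxE. Qed.

End dotp_theory.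

(** The triangle inequality for the seminorm, obtained from the Cauchy-Schwarz bound
    [C <= 2 * (p * q)]; [C] collects both cross terms. *)
Lemma psd_form_convex (R : rcfType) (A B C t u : R) :
  (forall x y, 0 <= x ^+ 2 * A + x * y * C + y ^+ 2 * B) -> 0 <= t -> 0 <= u ->
  Num.sqrt (t ^+ 2 * A + t * u * C + u ^+ 2 * B) <=
  t * Num.sqrt A + u * Num.sqrt B.
Proof.
move=> psd t0 u0.
have A0 : 0 <= A by have := psd 1 0; lra.
have B0 : 0 <= B by have := psd 0 1; lra.
set p := Num.sqrt A; set q := Num.sqrt B.
have p0 : 0 <= p by exact: sqrtr_ge0.
have q0 : 0 <= q by exact: sqrtr_ge0.
have EA : A = p ^+ 2 by rewrite sqr_sqrtr.
have EB : B = q ^+ 2 by rewrite sqr_sqrtr.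
suff C_le : C <= 2 * (p * q).
  rewrite -(ler_sqr (sqrtr_ge0 _)) ?nnegrE; last by rewrite addr_ge0// mulr_ge0.
  rewrite sqr_sqrtr// EA EB.
  have := ler_wpM2l (mulr_ge0 t0 u0) C_le.
  by rewrite sqrrD !exprMn; lra.
rewrite leNgt; apply/negP => C_gt.
have C0 : 0 < C by apply: le_lt_trans C_gt; rewrite !mulr_ge0.
have [pq0|pq_n0] := eqVneq (p * q) 0.
  (* One square term vanishes, so the form is affine in that variable; the chosen point gives it the
     value -1. *)
  move/eqP : pq0; rewrite mulf_eq0 => /orP[] /eqP z.
    have := psd (- (B + 1) / C) 1.
    rewrite EA z; have -> : - (B + 1) / C * 1 * C = - (B + 1).
      by field; rewrite gt_eqF.
    by lra.
  have := psd 1 (- (A + 1) / C).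
  rewrite EB z; have -> : 1 * (- (A + 1) / C) * C = - (A + 1).
    by field; rewrite gt_eqF.
  by lra.
have pq_gt0 : 0 < p * q by rewrite lt_neqAle eq_sym pq_n0 mulr_ge0.
(* At [(q, - p)] the form factors as [p * q * (2 * (p * q) - C)], negative if the bound fails. *)
have := psd q (- p); rewrite EA EB.
have -> : q ^+ 2 * p ^+ 2 + q * - p * C + (- p) ^+ 2 * q ^+ 2 =
          p * q * (2 * (p * q) - C) by ring.
by rewrite pmulr_rge0//; lra.
Qed.

(** The square root of a negative number is 0 by default, and [normal_prob m 0] is uniform on [0, 1]
    whatever [m] is. *)
Lemma gaussian_law_neg (R : realType) (m v : R) (A : set R) :
  v < 0 -> measurable A -> gaussian_law m v A = lebesgue_measure (`[0, 1] `&` A).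
Proof.
move=> v0 mA; rewrite /gaussian_law lt_eqF// ler0_sqrtr ?ltW//.
by rewrite /normal_prob /normal_pdf eqxx integral_indic.
Qed.

(** * Bands of affine forms in a Gaussian vector *)

Section gaussian.
Context (d : measure_display) (T : measurableType d) (R : realType)
    (P : probability T R) (n : nat) (xi : 'I_n -> {RV P >-> R})
    (mu : 'cV[R]_n) (Sigma : 'M[R]_n).
Hypothesis xi_gaussian : gaussian_vector xi mu Sigma.

(* If [a^T Sigma a] were negative, [a^T xi] and [2 a^T xi] would both have the
   junk law [normal_prob _ 0], uniform on [0, 1]. *)
Lemma gaussian_variance_ge0 a : 0 <= dotp a (Sigma *m a).
Proof.
rewrite leNgt; apply/negP => v0.
have [_ _ law] := xi_gaussian.
have v0' : dotp (2 *: a) (Sigma *m (2 *: a)) < 0.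
  by rewrite dotpZl -scalemxAr dotpZr !pmulr_rlt0.
(* The events [2 a^T xi] in [0, 1] and [a^T xi] in [0, 1/2] coincide, yet the uniform law would give
   them masses 1 and 1/2. *)
have := law a `[0, 2^-1]%classic (measurable_itv _).
have := law (2 *: a) `[0, 1]%classic (measurable_itv _).
rewrite !gaussian_law_neg//.
have -> : [set w | `[0, 1]%classic (dotp (2 *: a) (rvec xi w))] =
          [set w | `[0, 2^-1]%classic (dotp a (rvec xi w))].
  apply/seteqP; split => w /=; rewrite !in_itv/= dotpZl; lra.
move=> ->; rewrite setIid setIidr; last first.
  by apply: subset_itvl; rewrite bnd_simp; lra.
rewrite !lebesgue_measure_itv/= !lte_fin ltr01 invr_gt0 ltr0n.
by rewrite -!EFinB => -[]; lra.
Qed.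

Lemma gaussian_sd_convex a b t u : 0 <= t -> 0 <= u ->
  Num.sqrt (dotp (t *: a + u *: b) (Sigma *m (t *: a + u *: b))) <=
  t * Num.sqrt (dotp a (Sigma *m a)) + u * Num.sqrt (dotp b (Sigma *m b)).
Proof.
move=> t0 u0.
have E x y : dotp (x *: a + y *: b) (Sigma *m (x *: a + y *: b)) =
    x ^+ 2 * dotp a (Sigma *m a) +
    x * y * (dotp a (Sigma *m b) + dotp b (Sigma *m a)) +
    y ^+ 2 * dotp b (Sigma *m b).
  by rewrite mulmxDr -!scalemxAr !(dotpDl, dotpDr, dotpZl, dotpZr); ring.
rewrite E; apply: psd_form_convex => // x y.
by rewrite -E gaussian_variance_ge0.
Qed.

Lemma gaussian_bandP p a b f : 1 / 2 < p -> p <= 1 ->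
  (p%:E <= P [set w | `|dotp a (rvec xi w) + b| <= f]%R)%E <->
  band_ok p (dotp a mu + b) (Num.sqrt (dotp a (Sigma *m a))) f.
Proof.
move=> p2 p1; have [_ _ law] := xi_gaussian.
have mS : measurable [set x : R | `|x + b| <= f].
  rewrite (_ : mkset _ = `[- f - b, f - b]%classic)//.
  by apply/seteqP; split => x /=; rewrite in_itv/= ler_norml; lra.
rewrite (law a _ mS); apply: gaussian_law_bandP => //.
exact: gaussian_variance_ge0.
Qed.

Lemma gaussian_band_convex p t a1 b1 f1 a2 b2 f2 :
  1 / 2 < p -> p <= 1 -> 0 < t -> t < 1 ->
  (p%:E <= P [set w | `|dotp a1 (rvec xi w) + b1| <= f1]%R)%E ->
  (p%:E <= P [set w | `|dotp a2 (rvec xi w) + b2| <= f2]%R)%E ->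
  (p%:E <= P [set w | `|dotp (t *: a1 + (1 - t) *: a2) (rvec xi w) +
                        (t * b1 + (1 - t) * b2)| <= t * f1 + (1 - t) * f2]%R)%E.
Proof.
move=> p2 p1 t0 t1; rewrite !gaussian_bandP// => H1 H2.
have -> : dotp (t *: a1 + (1 - t) *: a2) mu + (t * b1 + (1 - t) * b2) =
    t * (dotp a1 mu + b1) + (1 - t) * (dotp a2 mu + b2).
  by rewrite dotpDl !dotpZl; ring.
apply: band_ok_convex H1 H2; rewrite ?sqrtr_ge0//.
by apply: gaussian_sd_convex; rewrite ?subr_ge0 ltW.
Qed.

End gaussian.

(** * Measurability of the events, and the union bound *)

Section measurability.
Context (d : measure_display) (T : measurableType d) (R : realType)
    (P : probability T R) (n : nat) (xi : 'I_n -> {RV P >-> R}).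
Implicit Types (a c : 'cV[R]_n) (b e f k : R).

Lemma measurable_affine_rvec a b :
  measurable_fun setT (fun w => dotp a (rvec xi w) + b).
Proof.
apply: measurable_funD => //; under eq_fun do rewrite dotpE.
apply: measurable_sum => i; apply: measurable_funM => //.
rewrite (_ : (fun w => _) = xi i); first exact: measurable_funPT.
by apply/funext => w; rewrite mxE.
Qed.

Lemma measurable_sublevel (g : T -> R) k :
  measurable_fun setT g -> measurable [set w | g w <= k].
Proof.
move=> mg; rewrite -[X in measurable X]setTI.
have -> : [set w | g w <= k] = g @^-1` `]-oo, k].
  by apply/seteqP; split => w /=; rewrite in_itv.
exact: mg.
Qed.

Lemma measurable_band a b f :
  measurable [set w | `|dotp a (rvec xi w) + b| <= f].
Proof.
apply: measurable_sublevel; apply: measurableT_comp => //.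
exact: measurable_affine_rvec.
Qed.

Lemma measurable_quadratic a b c e k :
  measurable [set w | (dotp a (rvec xi w) + b) ^+ 2 +
                      (dotp c (rvec xi w) + e) ^+ 2 <= k].
Proof.
apply: measurable_sublevel; apply: measurable_funD;
  by apply: measurable_funX; exact: measurable_affine_rvec.
Qed.

End measurability.

(** Subadditivity on the complements: the failure probabilities add up. *)
Lemma probability_setI_ge d (T : measurableType d) (R : realType)
    (P : probability T R) (A B : set T) (x y : R) :
  measurable A -> measurable B ->
  ((1 - x)%:E <= P A)%E -> ((1 - y)%:E <= P B)%E ->
  ((1 - (x + y))%:E <= P (A `&` B))%E.
Proof.
move=> mA mB.
have mAB : measurable (A `&` B) by exact: measurableI.
have : (P (setC A `|` setC B)%classic <= P (setC A) + P (setC B))%E.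
  by apply: measureU2; exact: measurableC.
rewrite -setCI !probability_setC//.
rewrite -(fineK (fin_num_measure P _ mA)) -(fineK (fin_num_measure P _ mB)).
rewrite -(fineK (fin_num_measure P _ mAB)) -!EFinB -EFinD !lee_fin.
by lra.
Qed.

(** * Convexity of the projection and its inclusion in the chance constraint set *)

Theorem lemma17 (d : measure_display) (T : measurableType d) (R : realType)
    (P : probability T R) (n : nat) (xi : 'I_n -> {RV P >-> R})
    (mu : 'cV[R]_n) (Sigma : 'M[R]_n) (eps beta : R)
    (xi_gaussian : gaussian_vector xi mu Sigma)
    (eps_gt0 : 0 < eps) (eps_lt_half : eps < 1 / 2)
    (beta_gt0 : 0 < beta) (beta_lt1 : beta < 1) :
  @convex_set R (qspace R n) (split_set_proj xi eps beta) /\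
  split_set_proj xi eps beta `<=` chance_set xi eps.
Proof.
(* Both risk shares stay below 1/2, so both levels exceed 1/2 as band convexity requires. *)
have e1 : 0 < beta * eps < 1 / 2.
  by rewrite mulr_gt0//=; apply: le_lt_trans eps_lt_half; rewrite ler_piMl ?ltW.
have e2 : 0 < (1 - beta) * eps < 1 / 2.
  rewrite mulr_gt0 ?subr_gt0//=; apply: le_lt_trans eps_lt_half.
  by rewrite ler_piMl ?ltW//; lra.
split; last first.
  move=> _ [[[[[[[a b] c] d'] k] f1] f2] [H1 H2 H3] <-].
  rewrite /chance_set /qproj/=.
  have := probability_setI_ge (measurable_band xi a b f1)
    (measurable_band xi c d' f2) H1 H2.
  rewrite -mulrDl [beta + _]addrC subrK mul1r => /le_trans; apply.
  apply: le_measure; rewrite ?inE.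
  - by apply: measurableI; exact: measurable_band.
  - exact: measurable_quadratic.
  (* At such an outcome [f1] and [f2] dominate absolute values, hence are nonnegative, and the
     bounds can be squared. *)
  - move=> w [/= X1 X2]; apply: le_trans H3.
    rewrite -(real_normK (num_real (_ + b))) -(real_normK (num_real (_ + d'))).
    by rewrite lerD// ler_sqr ?nnegrE// (le_trans _ X1, le_trans _ X2).
apply/convex_setW => x y; rewrite !inE.
move=> [[[[[[[a1 b1] c1] d1] k1] f1] g1] [P1 Q1 L1] <-].
move=> [[[[[[[a2 b2] c2] d2] k2] f2] g2] [P2 Q2 L2] <-] t t0 t1.
rewrite inE; set s := t%:num.
(* The lifted points are combined with the same weights, [f1] and [f2] included; convexity of the
   square then gives the last constraint. *)
exists (s *: a1 + (1 - s) *: a2, s * b1 + (1 - s) * b2,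
        s *: c1 + (1 - s) *: c2, s * d1 + (1 - s) * d2, s * k1 + (1 - s) * k2,
        s * f1 + (1 - s) * f2, s * g1 + (1 - s) * g2) => //; split.
- by apply: (gaussian_band_convex xi_gaussian) => //; lra.
- by apply: (gaussian_band_convex xi_gaussian) => //; lra.
- have s01 : 0 <= s * (1 - s) by rewrite mulr_ge0 ?subr_ge0 ?ltW.
  have sq (f g : R) :
      (s * f + (1 - s) * g) ^+ 2 <= s * f ^+ 2 + (1 - s) * g ^+ 2.
    rewrite -subr_ge0.
    have -> : s * f ^+ 2 + (1 - s) * g ^+ 2 - (s * f + (1 - s) * g) ^+ 2 =
      s * (1 - s) * (f - g) ^+ 2 by ring.
    by rewrite mulr_ge0// sqr_ge0.
  have L1' : s * (f1 ^+ 2 + g1 ^+ 2) <= s * k1 by rewrite ler_wpM2l// ltW.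
  have L2' : (1 - s) * (f2 ^+ 2 + g2 ^+ 2) <= (1 - s) * k2.
    by rewrite ler_wpM2l// subr_ge0 ltW.
  by have := sq f1 f2; have := sq g1 g2; lra.
Qed.
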